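(* Let $V$ be a 3-dimensional complex vector space with a Hermitian form $h$ of signature $(2,1)$. Let $z_1,z_2,z_3\in V$ be non-null vectors. Put $a_i=h(z_i,z_i)$, $h_{ij}=h(z_i,z_j)$, $q_{ij}=\dfrac{a_ia_j-|h_{ij}|^2}{a_ia_j}$, $D_{123}=\det(h_{ij})_{1\le i,j\le3}$, $$\Omega_{123}=\frac{h_{12}h_{23}h_{31}}{a_1a_2a_3},\qquad \Theta_{123}=\Omega_{123}+\overline{\Omega_{123}} .$$ Then $$\frac{D_{123}}{a_1a_2a_3}=q_{12}+q_{23}+q_{31}-2+\Theta_{123}$$ and $$\Omega_{123}\,\overline{\Omega_{123}}=(1-q_{12})(1-q_{23})(1-q_{31}).$$
   Context: $h$ is linear in the first argument and conjugate-linear in the second, with $h(w,z)=\overline{h(z,w)}$; a vector $z$ is non-null if $h(z,z)\neq0$. *)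

(* Defs.v *)
From HB Require Import structures.
From mathcomp Require Import all_boot all_order all_algebra.
From mathcomp Require Export sesquilinear.
From mathcomp Require Export reals.
From mathcomp Require Export complex.

Set Implicit Arguments.
Unset Strict Implicit.
Unset Printing Implicit Defensive.

Import Order.TTheory GRing.Theory Num.Theory.
Local Open Scope ring_scope.

Definition gram (K : numClosedFieldType) (V : lmodType K) (h : V -> V -> K)
    (n : nat) (z : 'I_n -> V) : 'M[K]_n :=
  \matrix_(i, j) h (z i) (z j).

(* Sylvester normal form: some basis of V has Gram matrix
   diag(1, .., 1, -1, .., -1), with p ones and q minus ones.
   In particular h is nondegenerate and V has dimension p + q. *)
Definition has_signature (K : numClosedFieldType) (V : vectType K)
    (h : V -> V -> K) (p q : nat) : Prop :=
  exists2 e : (p + q).-tuple V,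
    basis_of {:V}%VS e & gram h (tnth e) = block_mx 1%:M 0 0 (- 1%:M).

Definition non_null (K : numClosedFieldType) (V : lmodType K)
    (h : V -> V -> K) (z : V) : Prop := h z z != 0.

Definition q_inv (K : numClosedFieldType) (V : lmodType K)
    (h : V -> V -> K) (x y : V) : K :=
  (h x x * h y y - `|h x y| ^+ 2) / (h x x * h y y).

Definition Omega (K : numClosedFieldType) (V : lmodType K)
    (h : V -> V -> K) (x y z : V) : K :=
  (h x y * h y z * h z x) / (h x x * h y y * h z z).

Definition Theta (K : numClosedFieldType) (V : lmodType K)
    (h : V -> V -> K) (x y z : V) : K :=
  Omega h x y z + (Omega h x y z)^*.

(* Main.v *)
(** After hermitian symmetry replaces each conjugate [h(z_i,z_j)^*] by
    [h(z_j,z_i)], both claims are identities of rational functions in the nine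
    Gram entries, with denominators the nonzero [h(z_i,z_i)]. *)
Require Import Defs.
From mathcomp Require Import all_boot all_order all_algebra.
From mathcomp Require Import sesquilinear reals complex.
From mathcomp Require Import ring.

Import GRing.Theory Num.Theory.
Local Open Scope ring_scope.

(** Indexing entries by [nat] lets the shifted ordinals of the minors compute to numerals, so that
    [ring] can match them. *)
Lemma det_mx33 (R : comNzRingType) (F : nat -> nat -> R) :
  \det (\matrix_(i < 3, j < 3) F i j) =
    F 0 0 * (F 1 1 * F 2 2 - F 1 2 * F 2 1)
  - F 0 1 * (F 1 0 * F 2 2 - F 1 2 * F 2 0)
  + F 0 2 * (F 1 0 * F 2 1 - F 1 1 * F 2 0).
Proof.
rewrite (expand_det_row _ 0) !big_ord_recl big_ord0 /cofactor.
rewrite !(expand_det_row _ 0) !big_ord_recl !big_ord0 /cofactor !det_mx11.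
rewrite !mxE /= /bump /=; ring.
Qed.

Section HermitianTriple.

Variables (K : numClosedFieldType) (V : lmodType K).
Variable h : {hermitian V for false & Num.conj}.

Lemma herm_conj (x y : V) : (h x y)^* = h y x.
Proof. by rewrite [RHS]hermC expr0 mul1r. Qed.

Lemma sqr_norm_herm (x y : V) : `|h x y| ^+ 2 = h x y * h y x.
Proof. by rewrite normCK herm_conj. Qed.

(** Conjugation reverses the 3-cycle in the numerator; the diagonal values are real, so the
    denominator stays. *)
Lemma Omega_conj (x y z : V) :
  (Omega h x y z)^* = (h y x * h z y * h x z) / (h x x * h y y * h z z).
Proof. by rewrite /Omega fmorph_div !rmorphM /= !herm_conj. Qed.

Lemma det_gram3 (x y z : V) :
  \det (gram h (tnth [tuple x; y; z])) =
    h x x * (h y y * h z z - h y z * h z y)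
  - h x y * (h y x * h z z - h y z * h z x)
  + h x z * (h y x * h z y - h y y * h z x).
Proof.
(* The default [0] of [nth] is never reached, as indices stay below 3. *)
rewrite -(det_mx33 _ (fun i j => h (nth 0 [:: x; y; z] i) (nth 0 [:: x; y; z] j))).
by congr (\det _); apply/matrixP => i j; rewrite !mxE !(tnth_nth 0).
Qed.

(** In the normalized Leibniz expansion the identity gives 1, each transposition gives some
    $q_{ij}-1$, and the two 3-cycles give $\Omega$ and its conjugate; hence the constant
    $1-3=-2$. *)
Lemma det_gram3_q_inv (x y z : V) :
  non_null h x -> non_null h y -> non_null h z ->
  \det (gram h (tnth [tuple x; y; z])) / (h x x * h y y * h z z)
    = q_inv h x y + q_inv h y z + q_inv h z x - 2%:R + Theta h x y z.
Proof.
rewrite /non_null => hx hy hz.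
rewrite det_gram3 /Theta Omega_conj /Omega /q_inv !sqr_norm_herm.
by field; rewrite hx hy hz.
Qed.

(** The two opposite 3-cycles pair up into factors $h_{ij}h_{ji}/(a_ia_j)=1-q_{ij}$. *)
Lemma Omega_mul_conj (x y z : V) :
  non_null h x -> non_null h y -> non_null h z ->
  Omega h x y z * (Omega h x y z)^*
    = (1 - q_inv h x y) * (1 - q_inv h y z) * (1 - q_inv h z x).
Proof.
rewrite /non_null => hx hy hz.
rewrite Omega_conj /Omega /q_inv !sqr_norm_herm.
by field; rewrite hx hy hz.
Qed.

End HermitianTriple.

Theorem theorem10p2 (R : realType) (V : vectType R[i])
    (hdim : \dim {:V}%VS = 3%N)
    (h : {hermitian V for false & Num.conj})
    (hsig : has_signature h 2 1)
    (z1 z2 z3 : V)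
    (hz1 : non_null h z1) (hz2 : non_null h z2) (hz3 : non_null h z3) :
  \det (gram h (tnth [tuple z1; z2; z3]))
      / (h z1 z1 * h z2 z2 * h z3 z3)
    = q_inv h z1 z2 + q_inv h z2 z3 + q_inv h z3 z1 - 2%:R + Theta h z1 z2 z3
  /\
  Omega h z1 z2 z3 * (Omega h z1 z2 z3)^*
    = (1 - q_inv h z1 z2) * (1 - q_inv h z2 z3) * (1 - q_inv h z3 z1).
Proof. by split; [apply: det_gram3_q_inv | apply: Omega_mul_conj]. Qed.
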